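(* For every real $\epsilon > 0$ there is a set $\mathcal{C}_{\epsilon}$ of critical graphs such that: (1) $\iota(G) \leq \frac{1}{2}$ for every $G \in \mathcal{C}$ if and only if $\iota(G) \leq \frac{1}{2}$ for every $G \in \mathcal{C}_{\epsilon}$; (2) if $G \in \mathcal{C}_{\epsilon}$, then $\iota(G) < \frac{1}{2} + \epsilon$.
   Context: All graphs are finite and simple. $\Delta(G)$ is the maximum degree of $G$. A $k$-edge-coloring of $G$ is a function $\phi: E(G) \to \{1,\dots,k\}$ with $\phi(e)\neq\phi(f)$ for adjacent edges $e,f$; the chromatic index $\chi'(G)$ is the smallest $k$ such that $G$ has a $k$-edge-coloring. For $k \geq 2$, a connected graph $G$ is $k$-critical if $\Delta(G)=k$, $\chi'(G)=k+1$ and $\chi'(G-e)=k$ for every $e \in E(G)$. $\mathcal{C}(k)$ denotes the set of $k$-critical graphs and $\mathcal{C}=\bigcup_{k=2}^{\infty}\mathcal{C}(k)$ the set of critical graphs. $\alpha(G)$ is the maximum cardinality of an independent set of vertices of $G$, and $\iota(G)=\alpha(G)/|V(G)|$ is the independence ratio of $G$. *)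

(* Defs.v *)
From HB Require Import structures.
From mathcomp Require Import all_boot all_order all_algebra.
From mathcomp Require Import reals.

Set Implicit Arguments.
Unset Strict Implicit.
Unset Printing Implicit Defensive.

Import Order.TTheory GRing.Theory Num.Theory.

(* A set of graphs is a predicate [sgraph -> Prop]: the type [set sgraph] of
   mathcomp-analysis is ruled out by universe constraints, since [sgraph]
   quantifies over [finType]. *)
Record sgraph := SGraph {
  vertex :> finType;
  adj : rel vertex;
  adj_sym : symmetric adj;
  adj_irrefl : irreflexive adj }.

Definition edges (G : sgraph) : {set {set G}} :=
  [set [set p.1; p.2] | p : G * G & adj p.1 p.2].

(* The type of edges, so that a coloring is a function on E(G) only. *)
Definition edge (G : sgraph) : finType := {e : {set G} | e \in edges G}.

Definition adjacent_edges (G : sgraph) (e f : edge G) : bool :=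
  (e != f) && ~~ [disjoint val e & val f].

Definition max_degree (G : sgraph) : nat :=
  \max_(x : G) #|[set y : G | adj x y]|.

Definition is_edge_coloring (G : sgraph) (k : nat)
    (phi : {ffun edge G -> 'I_k}) : bool :=
  [forall e, forall f, adjacent_edges e f ==> (phi e != phi f)].

Definition edge_colorable (G : sgraph) (k : nat) : bool :=
  [exists phi : {ffun edge G -> 'I_k}, is_edge_coloring phi].

Lemma ex_edge_colorable (G : sgraph) : exists k, edge_colorable G k.
Proof.
exists #|edge G|; apply/existsP; exists [ffun e => enum_rank e].
apply/forallP => e; apply/forallP => f; apply/implyP => /andP[ef _].
by rewrite !ffunE (inj_eq enum_rank_inj).
Qed.

Definition chromatic_index (G : sgraph) : nat := ex_minn (ex_edge_colorable G).

Section DeleteEdge.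
Variables (G : sgraph) (e : edge G).

Definition del_adj : rel G :=
  fun x y => adj x y && ([set x; y] != val e).

Lemma del_adj_sym : symmetric del_adj.
Proof. by move=> x y; rewrite /del_adj adj_sym setUC. Qed.

Lemma del_adj_irrefl : irreflexive del_adj.
Proof. by move=> x; rewrite /del_adj adj_irrefl. Qed.

Definition delete_edge : sgraph := SGraph del_adj_sym del_adj_irrefl.
End DeleteEdge.

Definition connected_graph (G : sgraph) : Prop :=
  forall x y : G, connect (@adj G) x y.

Definition k_critical (k : nat) (G : sgraph) : Prop :=
  [/\ connected_graph G,
      max_degree G = k,
      chromatic_index G = k.+1 &
      forall e : edge G, chromatic_index (delete_edge e) = k].

Definition critical (G : sgraph) : Prop :=
  exists k : nat, 2 <= k /\ k_critical k G.

Definition independent (G : sgraph) (S : {set G}) : bool :=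
  [forall x in S, forall y in S, ~~ adj x y].

Definition independence_number (G : sgraph) : nat :=
  \max_(S : {set G} | independent S) #|S|.

Definition independence_ratio (R : realType) (G : sgraph) : R :=
  ((independence_number G)%:R / #|G|%:R)%R.

(* Main.v *)
(* Let v be a vertex of maximum degree k of a k-critical graph G, and let G' be
   its Meredith extension: v is replaced by a copy of K_(k,k-1) whose k vertices
   of degree k-1 ("ports") each receive one of the edges of v. In a k-edge-coloring
   of G' every color occurs at each of the k-1 remaining vertices ("cores"), which
   forces distinct colors on the k outer edges; conversely a coloring of G with
   one edge removed extends over K_(k,k-1) by a cyclic Latin square. Hence G' is
   again k-critical. Moreover alpha grows by k-1 and the order by 2(k-1), so
   alpha - n/2 is unchanged. Iterating the extension from a counterexample to
   iota <= 1/2 thus gives counterexamples whose ratio tends to 1/2, and C_eps may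
   be taken to be all critical graphs of ratio < 1/2 + eps. *)
From HB Require Import structures.
Require Import Defs.
From mathcomp Require Import all_boot all_order all_fingroup all_algebra.
From mathcomp Require Import reals lra.

Set Implicit Arguments.
Unset Strict Implicit.
Unset Printing Implicit Defensive.

Import Order.TTheory GRing.Theory Num.Theory.

(** * Two-element sets, injections and pigeonhole *)

Lemma eq_set2 (T : finType) (x y u w : T) :
  ([set x; y] == [set u; w]) = ((x == u) && (y == w)) || ((x == w) && (y == u)).
Proof.
apply/eqP/orP => [E|[/andP[/eqP-> /eqP->]|/andP[/eqP-> /eqP->]]] //; last first.
  by rewrite setUC.
have : [&& x \in [set u; w], y \in [set u; w], u \in [set x; y] & w \in [set x; y]].
  by rewrite -E E -{1 2}E !inE !eqxx !orbT.
rewrite !inE !(eq_sym u) !(eq_sym w).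
by case: (x == u); case: (x == w); case: (y == u); case: (y == w) => //=; auto.
Qed.

Lemma set2_inj (T : finType) (x y z : T) : [set x; y] = [set x; z] -> y = z.
Proof.
by move/eqP; rewrite eq_set2 eqxx => /orP[/eqP//|/andP[/eqP-> /eqP->]].
Qed.

Lemma card_le_inj_in (T T' : finType) (f : T -> T') (A : {set T}) (B : {set T'}) :
  {in A &, injective f} -> {in A, forall x, f x \in B} -> #|A| <= #|B|.
Proof.
move=> f_inj fAB; rewrite -(card_in_imset f_inj); apply/subset_leq_card/subsetP.
by move=> _ /imsetP[x xA ->]; apply: fAB.
Qed.

Lemma missing_color (T : finType) (n : nat) (f : T -> 'I_n) (S : {set T}) :
  #|S| < n -> exists i, forall z, z \in S -> f z != i.
Proof.
move=> ltSn; have /card_gt0P[i] : 0 < #|~: (f @: S)|.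
  rewrite -(ltn_add2l #|f @: S|) cardsC addn0 card_ord.
  exact: leq_ltn_trans (leq_imset_card _ _) ltSn.
rewrite inE => fi; exists i => z zS; apply: contraNneq fi => <-.
exact: imset_f.
Qed.

(** * Edge colorings as symmetric functions of two vertices *)

Lemma edgeP (G : sgraph) (e : edge G) :
  exists x y : G, adj x y /\ val e = [set x; y].
Proof.
by case: e => /= s /imsetP[[x y]]; rewrite inE /= => xy ->; exists x, y.
Qed.

Lemma adj_edge (G : sgraph) (x y : G) :
  adj x y -> exists e : edge G, val e = [set x; y].
Proof.
move=> xy; have h : [set x; y] \in edges G.
  by apply/imsetP; exists (x, y); rewrite ?inE.
by exists (exist (fun e => e \in edges G) _ h).
Qed.

(** A color is attached to every ordered pair, with arbitrary values off the relation, so that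
    colorings of different graphs can be compared without transporting edges between subtypes. *)
Definition proper_coloring (T : Type) (r : rel T) (C : Type) (c : T -> T -> C) : Prop :=
  (forall x y, c x y = c y x) /\
  (forall x y z, r x y -> r x z -> c x y = c x z -> y = z).

(** The successor in [k.+1] supplies [ord0] as a default color for pairs that are not edges. *)
Lemma edge_colorableP (G : sgraph) (k : nat) :
  edge_colorable G k.+1 <->
  exists c : G -> G -> 'I_k.+1, proper_coloring (@adj G) c.
Proof.
split=> [/existsP[phi /forallP phiP]|[c [c_sym c_prop]]].
  exists (fun x y => if insub [set x; y] is Some e then phi e else ord0).
  split=> [x y|x y z xy xz]; first by rewrite setUC.
  have [[e Ee] [f Ef]] := (adj_edge xy, adj_edge xz).
  rewrite -Ee -Ef !valK => /eqP; have /forallP/(_ f) := phiP e.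
  case: (altP (phi e =P phi f)) => //=; rewrite implybF negb_and !negbK => _.
  case/orP=> [/eqP ef _|dis _].
    by apply: (@set2_inj _ x); rewrite -Ee -Ef ef.
  by have := disjointFr dis (_ : x \in _); rewrite Ee Ef !set21 => /(_ isT).
(* The ends of [e] are picked in an arbitrary order, which is harmless since [c] is symmetric. *)
pose phi (e : edge G) :=
  if [pick p : G * G | val e == [set p.1; p.2]] is Some p then c p.1 p.2 else ord0.
have phiE e x y : val e = [set x; y] -> phi e = c x y.
  move=> Ee; rewrite /phi; case: pickP => [[u w] /=|/(_ (x, y))]; last by rewrite Ee eqxx.
  by rewrite Ee eq_set2 => /orP[] /andP[/eqP<- /eqP<-].
apply/existsP; exists [ffun e => phi e].
apply/forallP=> e; apply/forallP=> f; apply/implyP=> /andP[ef /pred0Pn[z /andP[/= ze zf]]].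
have end_of (g : edge G) : z \in val g -> exists2 x, adj z x & val g = [set z; x].
  have [x [y [xy ->]]] := edgeP g; rewrite !inE => /orP[] /eqP->; first by exists y.
  by exists x; rewrite 1?adj_sym 1?setUC.
have [[x zx Ee] [y zy Ef]] := (end_of e ze, end_of f zf).
rewrite !ffunE (phiE _ _ _ Ee) (phiE _ _ _ Ef).
apply: contra ef => /eqP /(c_prop _ _ _ zx zy) xy.
by apply/eqP/val_inj; rewrite Ee Ef xy.
Qed.

(** * Criticality in terms of colorability *)

Lemma edge_colorable_mono (G : sgraph) (k l : nat) :
  k <= l -> edge_colorable G k -> edge_colorable G l.
Proof.
move=> kl /existsP[phi /forallP phiP]; apply/existsP.
exists [ffun e => widen_ord kl (phi e)]; apply/forallP=> e; apply/forallP=> f.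
by rewrite !ffunE; have /forallP/(_ f) := phiP e.
Qed.

Lemma chromatic_index_leq (G : sgraph) (k : nat) :
  (chromatic_index G <= k) = edge_colorable G k.
Proof.
rewrite /chromatic_index; case: ex_minnP => n col_n min_n.
by apply/idP/idP=> [/edge_colorable_mono->//|/min_n].
Qed.

(** The restored edge receives the new color [ord_max]. *)
Lemma edge_colorable_delete (G : sgraph) (e : edge G) (k : nat) :
  edge_colorable (delete_edge e) k.+1 -> edge_colorable G k.+2.
Proof.
case/edge_colorableP=> c [c_sym c_prop]; apply/edge_colorableP.
exists (fun x y => if [set x; y] == val e then ord_max
                   else widen_ord (leqnSn _) (c x y)).
have neq_max (i : 'I_k.+1) : widen_ord (leqnSn _) i = ord_max -> False.
  by move=> /(congr1 val) /= E; have := ltn_ord i; rewrite E ltnn.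
split=> [x y|x y z xy xz]; first by rewrite setUC c_sym.
case: eqP => [Ey|/eqP ny]; case: eqP => [Ez|/eqP nz].
- by move=> _; apply: (@set2_inj _ x); rewrite Ey Ez.
- by move=> /esym /neq_max.
- by move=> /neq_max.
move=> /(congr1 val) /= /val_inj; apply: c_prop; exact/andP.
Qed.

(** Deleting an edge lowers the chromatic index by at most one, so the two colorability conditions
    already fix both exact values. *)
Lemma k_criticalP (k : nat) (G : sgraph) :
  k_critical k.+2 G <->
  [/\ connected_graph G, max_degree G = k.+2, ~~ edge_colorable G k.+2 &
      forall e : edge G, edge_colorable (delete_edge e) k.+2].
Proof.
split=> [[conn deg chi del]|[conn deg ncol del]].
  split=> // [|e]; first by rewrite -chromatic_index_leq chi ltnn.
  by rewrite -chromatic_index_leq del.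
have chi : k.+2 < chromatic_index G by rewrite ltnNge chromatic_index_leq.
have del' (e : edge G) : chromatic_index (delete_edge e) = k.+2.
  apply/eqP; rewrite eqn_leq chromatic_index_leq del ltnNge chromatic_index_leq.
  by apply: contra ncol => /edge_colorable_delete.
split=> //; apply/eqP; rewrite eqn_leq chi andbT chromatic_index_leq.
(* The positive maximum degree provides an edge to delete. *)
have [x /card_gt0P[y]] : exists x : G, 0 < #|[set y | adj x y]|.
  apply/existsP; apply: contraT => /existsPn h; move: deg; rewrite /max_degree big1 // => x _.
  by apply/eqP; have := h x; rewrite lt0n negbK.
by rewrite inE => /adj_edge[e _]; apply: (@edge_colorable_delete _ e).
Qed.

(** * Independent sets *)

Lemma independentP (G : sgraph) (S : {set G}) :
  reflect (forall x y, x \in S -> y \in S -> ~~ adj x y) (independent S).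
Proof.
apply: (iffP forall_inP) => [h x y xS yS|h x xS]; first by have /forall_inP/(_ y yS) := h x xS.
by apply/forall_inP=> y; apply: h.
Qed.

Lemma leq_independence_number (G : sgraph) (S : {set G}) :
  independent S -> #|S| <= independence_number G.
Proof. by move=> indS; apply: (@leq_bigmax_cond _ (@independent G) (fun S : {set G} => #|S|) S). Qed.

Lemma max_independent (G : sgraph) :
  exists2 S : {set G}, independent S & independence_number G = #|S|.
Proof.
have ind0 : independent (set0 : {set G}) by apply/independentP=> x y; rewrite inE.
have [|S indS ES] := @eq_bigmax_cond _ (@independent G) (fun S => #|S|).
  by apply/card_gt0P; exists set0.
by exists S.
Qed.

(** * Construction of the Meredith extension *)

Section MeredithExtension.
Variables (k : nat) (G : sgraph) (v : G).

Definition old := {x : G | x != v}.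
(** Ports are indexed by the neighbors of [v]: the port [a] receives the edge from [v] to
    [val a]. *)
Definition port := {x : G | adj v x}.
Definition mvertex : Type := (old + (port + 'I_k.+1))%type.
HB.instance Definition _ := Finite.on mvertex.

Definition Old (x : old) : mvertex := inl x.
Definition Port (a : port) : mvertex := inr (inl a).
Definition Core (b : 'I_k.+1) : mvertex := inr (inr b).

Definition meredith_adj : rel mvertex := fun u w =>
  match u, w with
  | inl x, inl y => adj (val x) (val y)
  | inl x, inr (inl a) | inr (inl a), inl x => val x == val a
  | inr (inl _), inr (inr _) | inr (inr _), inr (inl _) => true
  | _, _ => false
  end.

Lemma meredith_adj_sym : symmetric meredith_adj.
Proof. by move=> [x|[a|b]] [y|[a'|b']] //=; rewrite adj_sym. Qed.

Lemma meredith_adj_irrefl : irreflexive meredith_adj.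
Proof. by move=> [x|[a|b]] //=; rewrite adj_irrefl. Qed.

Definition meredith : sgraph := SGraph meredith_adj_sym meredith_adj_irrefl.

Lemma old_neq (x : old) : val x != v.
Proof. by case: x. Qed.

Lemma port_neq (a : port) : val a != v.
Proof. by apply: contraTneq (valP a) => ->; rewrite adj_irrefl. Qed.

Definition port_end (a : port) : old := exist (fun x => x != v) (val a) (port_neq a).

Hypothesis deg_v : #|[set y | adj v y]| = k.+2.

Lemma card_port : #|{: port}| = k.+2.
Proof. by rewrite card_sig -deg_v cardsE. Qed.

(** * From colorings of the extension to colorings of the graph *)

Section Restrict.
Variable c : meredith -> meredith -> 'I_k.+2.
Hypothesis c_proper : proper_coloring (@adj meredith) c.

(* If two outer edges had the same color, the k.+1 edges of that color at the
   cores would have to end in the remaining k ports. *)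
Lemma port_colors_inj : injective (fun a => c (Port a) (Old (port_end a))).
Proof.
have [c_sym c_prop] := c_proper.
move=> a1 a2 /=; set color := c (Port a1) _ => eq_color.
(* The k+2 edges at a core have distinct colors, so every color occurs there; [g] sends a core to
   the port at the end of its edge of color [color]. *)
have /fin_all_exists[g gP] (b : 'I_k.+1) : exists a, c (Core b) (Port a) = color.
  have /inj_card_onto onto : injective (fun a => c (Core b) (Port a)).
    by move=> a a' /c_prop-/(_ isT isT)[].
  rewrite card_port card_ord in onto.
  by have /codomP[a ->] := onto (leqnn _) color; exists a.
have g_inj : injective g.
  move=> b b' gb; have := gP b; rewrite -(gP b') gb !(c_sym _ (Port _)).
  by move=> /c_prop-/(_ isT isT)[].
have g_neq b a : color = c (Port a) (Old (port_end a)) -> g b != a.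
  move=> Ea; apply/eqP=> gb; have := gP b.
  by rewrite gb Ea c_sym => /c_prop-/(_ isT (eqxx _)).
apply/eqP; apply: contraT => a12.
have : #|codom g| <= #|~: [set a1; a2]|.
  apply/subset_leq_card/subsetP=> _ /codomP[b ->].
  by rewrite !inE negb_or !g_neq.
rewrite card_codom // card_ord.
have /eqP := cardsC [set a1; a2]; rewrite cards2 a12 card_port eqn_add2l => /eqP->.
by rewrite ltnn.
Qed.

(* The end at the side of [x] of the edge of the extension that corresponds to
   the edge [xy] of [G]; the value [Core ord0] is junk. *)
Definition end_at (x y : G) : meredith :=
  if insub x is Some x' then Old x'
  else if insub y is Some a then Port a else Core ord0.

Lemma end_at_old (x y : G) (xv : x != v) :
  end_at x y = Old (exist (fun x => x != v) x xv).
Proof. by rewrite /end_at insubT. Qed.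

Lemma end_at_port (y : G) (vy : adj v y) :
  end_at v y = Port (exist (fun y => adj v y) y vy).
Proof. by rewrite /end_at insubF ?eqxx // insubT. Qed.

Lemma adj_end_at (x y : G) : adj x y -> adj (end_at x y) (end_at y x).
Proof.
have [->|xv] := eqVneq x v; have [->|yv] := eqVneq y v; rewrite ?adj_irrefl //.
- by move=> vy; rewrite end_at_port end_at_old /= eqxx.
- by rewrite adj_sym => vx; rewrite end_at_port end_at_old /= eqxx.
by rewrite !end_at_old.
Qed.

Lemma end_at_inj (x y z : G) : adj x y -> adj x z -> end_at y x = end_at z x -> y = z.
Proof.
have [->|yv] := eqVneq y v; have [->|zv] := eqVneq z v => //.
- by rewrite adj_sym => vx xz; rewrite end_at_port end_at_old.
- by move=> xy; rewrite adj_sym => vx; rewrite end_at_port end_at_old.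
by rewrite !end_at_old => _ _ [].
Qed.

(** Edges meeting at [x] other than [v] still meet at [Old x]; those at [v] become outer edges at
    different ports and are told apart by [port_colors_inj]. *)
Lemma proper_restrict :
  proper_coloring (@adj G) (fun x y => c (end_at x y) (end_at y x)).
Proof.
have [c_sym c_prop] := c_proper; split=> [x y|x y z xy xz]; first exact: c_sym.
have [xv|xv] := eqVneq x v.
  rewrite {}xv in xy xz *; rewrite !end_at_port.
  have yv := port_neq (exist _ y xy); have zv := port_neq (exist _ z xz).
  have {1}-> : end_at y v = Old (port_end (exist (fun y => adj v y) y xy)).
    by rewrite end_at_old; congr Old; apply: val_inj.
  have -> : end_at z v = Old (port_end (exist (fun y => adj v y) z xz)).
    by rewrite end_at_old; congr Old; apply: val_inj.
  by move/port_colors_inj => [].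
move=> E; apply: (@end_at_inj x) => //.
apply: (c_prop (end_at x y)) => //; first exact: adj_end_at.
  by rewrite (end_at_old y xv) -(end_at_old z xv); apply: adj_end_at.
by rewrite E; congr c; rewrite !end_at_old.
Qed.

End Restrict.

Lemma meredith_uncolorable : ~~ edge_colorable G k.+2 -> ~~ edge_colorable meredith k.+2.
Proof.
apply: contra => /edge_colorableP[c c_proper]; apply/edge_colorableP.
by eexists; apply: proper_restrict c_proper.
Qed.

(** * From colorings of the graph to colorings of the extension minus an edge *)

Section Extend.
Variables (e : edge meredith) (c : G -> G -> 'I_k.+2) (inner outer : port -> 'I_k.+2).
Variable s : 'I_k.+2 -> 'I_k.+2.
Hypothesis c_sym : forall x y, c x y = c y x.
Hypothesis c_prop : forall x y z : old,
  del_adj e (Old x) (Old y) -> del_adj e (Old x) (Old z) ->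
  c (val x) (val y) = c (val x) (val z) -> y = z.
Hypothesis outer_old : forall (a : port) (y : old),
  del_adj e (Old (port_end a)) (Port a) -> del_adj e (Old (port_end a)) (Old y) ->
  c (val a) (val y) != outer a.
Hypothesis inner_inj : injective inner.
Hypothesis s_inj : injective s.
Hypothesis outer_core : forall (a : port) (b : 'I_k.+1),
  del_adj e (Old (port_end a)) (Port a) -> del_adj e (Port a) (Core b) ->
  (inner a + s (lift ord0 b))%R != outer a.

(* Colors are added in Z/(k+2), where core [b] has the nonzero label [lift ord0 b]:
   at port [a] every color but [inner a] is used. The outer edge may get a color
   [outer a] different from [inner a] when an edge at the port is deleted. *)
Definition extend_coloring (u w : meredith) : 'I_k.+2 :=
  match u, w with
  | inl x, inl y => c (val x) (val y)
  | inl _, inr (inl a) | inr (inl a), inl _ => outer a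
  | inr (inl a), inr (inr b) | inr (inr b), inr (inl a) => (inner a + s (lift ord0 b))%R
  | _, _ => ord0
  end.

(** Clashes at old vertices are excluded by [c_prop] and [outer_old], at ports by [s_inj] and
    [outer_core], at cores by [inner_inj]. An old vertex has at most one port as neighbor and a port
    has only one old neighbor. *)
Lemma extend_coloringP : edge_colorable (delete_edge e) k.+2.
Proof.
apply/edge_colorableP; exists extend_coloring; split=> [[x|[a|b]] [y|[a'|b']] //=|].
have adjP (u w : meredith) : @adj (delete_edge e) u w -> adj u w /\ del_adj e u w.
  by move=> h; split=> //; case/andP: h.
have port_endE (x : old) (a : port) : val x = val a -> x = port_end a.
  by move=> xa; apply: val_inj.
move=> [x|[a|b]] [y|[a'|b']] [z|[a''|b'']] //= /adjP[/= h1 d1] /adjP[/= h2 d2] //.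
- by move=> /c_prop->.
- rewrite (port_endE _ _ (eqP h2)) in d1 d2 *.
  by have /eqP := outer_old d2 d1.
- rewrite (port_endE _ _ (eqP h1)) in d1 d2 *.
  by have /eqP h := outer_old d1 d2 => /esym.
- by move=> _; congr (inr (inl _)); apply: val_inj; apply: etrans (esym (eqP h1)) (eqP h2).
- by move=> _; congr inl; apply: val_inj; apply: etrans (eqP h1) (esym (eqP h2)).
- move: h1 d1 => /eqP/port_endE ->; rewrite [del_adj _ _ _](@del_adj_sym meredith).
  by move=> /outer_core/(_ d2)/eqP h /esym.
- move: h2 d2 => /eqP/port_endE ->; rewrite [del_adj _ _ _](@del_adj_sym meredith).
  by move=> /outer_core/(_ d1)/eqP.
- by move=> /addrI/s_inj/lift_inj->.
by move=> /addIr/inner_inj->.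
Qed.

End Extend.

(** * Every edge-deleted extension is colorable *)

Section Criticality.
Hypothesis max_deg : max_degree G = k.+2.
Hypothesis uncol : ~~ edge_colorable G k.+2.
Hypothesis del_col : forall e : edge G, edge_colorable (delete_edge e) k.+2.

(* With the edge of [a0] at [v] deleted, [c0] is a color missing at [v] and [c1]
   one missing at the other end. The outer edge of [a0] is colored [c1], which
   can only clash with one edge from [a0] to a core; relabelling by [s] makes that
   edge the deleted one. *)
Lemma port_extension (a0 : port) :
  exists c0 c1 : 'I_k.+2, c0 != c1 /\ forall (e : edge meredith) (s : 'I_k.+2 -> 'I_k.+2),
    injective s -> s 0%R = 0%R ->
    (forall b, del_adj e (Old (port_end a0)) (Port a0) -> del_adj e (Port a0) (Core b) ->
       (c0 + s (lift ord0 b))%R != c1) ->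
    edge_colorable (delete_edge e) k.+2.
Proof.
have [e0 De0] := adj_edge (valP a0).
have /edge_colorableP[c [c_sym c_prop]] := del_col e0.
have del0 (x y : G) : @adj (delete_edge e0) x y = adj x y && ([set x; y] != [set v; val a0]).
  by rewrite -De0.
have a0v := port_neq a0.
have [|c0 c0P] := @missing_color _ _ (c v) ([set y | adj v y] :\ val a0).
  by have := cardsD1 (val a0) [set y | adj v y]; rewrite deg_v inE (valP a0) add1n => <-.
have [|c1 c1P] := @missing_color _ _ (c (val a0)) ([set y | adj (val a0) y] :\ v).
  have := cardsD1 v [set y | adj (val a0) y].
  rewrite inE adj_sym (valP a0) add1n => <-; rewrite -max_deg.
  exact: (leq_bigmax (val a0)).
have c0_free y : adj v y -> y != val a0 -> c v y != c0.
  by move=> vy ya; apply: c0P; rewrite !inE ya.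
have c1_free y : adj (val a0) y -> y != v -> c (val a0) y != c1.
  by move=> vy ya; apply: c1P; rewrite !inE ya.
exists c0, c1; split.
  (* A color missing at both ends could be given to the deleted edge, which would color all of
     [G]. *)
  apply: contra uncol => /eqP c01; apply/edge_colorableP.
  exists (fun x y => if [set x; y] == [set v; val a0] then c0 else c x y).
  split=> [x y|x y z xy xz]; first by rewrite setUC c_sym.
  have free w : adj x w -> forall u, [set x; u] == [set v; val a0] ->
      [set x; w] != [set v; val a0] -> c x w != c0.
    move=> xw u; rewrite !eq_set2 => /orP[]/andP[/eqP xE _].
      by rewrite xE eqxx (eq_sym v) (negPf a0v) orbF /= => wa; apply: c0_free; rewrite -?xE.
    rewrite xE eqxx (negPf a0v) /= => wv; rewrite c01.
    by apply: c1_free; rewrite -?xE.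
  case: ifPn => Ey; case: ifPn => Ez.
  - by move=> _; apply: (@set2_inj _ x); rewrite (eqP Ey) (eqP Ez).
  - by move=> E; have := free _ xz _ Ey Ez; rewrite E eqxx.
  - by move=> E; have := free _ xy _ Ez Ey; rewrite E eqxx.
  by apply: c_prop; rewrite del0; apply/andP.
move=> e s s_inj s0 core0.
(* Since [s] fixes 0, core labels stay nonzero; at a port with equal inner and outer color no core
   edge can then clash with the outer one. *)
have nz b : s (lift ord0 b) != 0%R.
  by rewrite -[X in _ != X]s0 (inj_eq s_inj) eq_sym neq_lift.
have neq_a0 (a : port) : a != a0 -> val a != val a0 by rewrite (inj_eq val_inj).
have not_v0 (x y : G) : x != v -> y != v -> [set x; y] != [set v; val a0].
  by move=> xv yv; rewrite eq_set2 (negPf xv) (negPf yv) andbF.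
have not_0 (a : port) : a != a0 -> [set v; val a] != [set v; val a0].
  by move/neq_a0 => aa0; apply: contra aa0 => /eqP/set2_inj->.
(* Ports other than [a0] use the color of their edge at [v] as both inner and outer color. Inner
   colors stay distinct because [c0] is missing at [v]. *)
apply: (@extend_coloringP e c (fun a => if a == a0 then c0 else c v (val a))
          (fun a => if a == a0 then c1 else c v (val a)) s) => //.
- move=> x y z /andP[xy _] /andP[xz _] E; apply: val_inj.
  by apply: c_prop E; rewrite del0 not_v0 ?andbT // old_neq.
- move=> a y _ /andP[]; rewrite /= => ay _; case: (eqVneq a a0) => [aa0|aa0].
    by rewrite aa0 in ay *; apply: c1_free => //; apply: old_neq.
  rewrite (c_sym v); apply: contraNneq (old_neq y) => E.
  apply/eqP; apply: c_prop E; rewrite del0.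
    by rewrite ay not_v0 //; [apply: port_neq|apply: old_neq].
  by rewrite adj_sym (valP a) setUC not_0.
- move=> a b; case: (eqVneq a a0) => [->|aa]; case: (eqVneq b a0) => [->|ba] //.
  + by move/esym/eqP; rewrite (negPf (c0_free _ (valP b) (neq_a0 _ ba))).
  + by move/eqP; rewrite (negPf (c0_free _ (valP a) (neq_a0 _ aa))).
  + move/c_prop=> ab; apply: val_inj; apply: ab; rewrite del0 ?(valP a) ?(valP b) /=.
      exact: not_0.
    exact: not_0.
move=> a b ea eb; case: (eqVneq a a0) => [aa0|aa0]; first by rewrite aa0 in ea eb; apply: core0.
by rewrite -[X in _ != X]addr0 (inj_eq (@addrI _ _)).
Qed.

Lemma meredith_delete (e : edge meredith) : edge_colorable (delete_edge e) k.+2.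
Proof.
have del_self (u w : meredith) : val e = [set u; w] -> del_adj e u w = false.
  by move=> De; rewrite /del_adj De eqxx andbF.
have [u [w [uw De]]] := edgeP e.
have case_port (a : port) : val e = [set Old (port_end a); Port a] ->
    edge_colorable (delete_edge e) k.+2.
  move=> Da; have [c0 [c1 [_ ext]]] := port_extension a.
  (* When the outer edge itself is deleted, the clash condition is vacuous. *)
  by apply: (ext e id) => // b; rewrite del_self.
have case_core (a : port) b : val e = [set Port a; Core b] ->
    edge_colorable (delete_edge e) k.+2.
  move=> Da; have [c0 [c1 [c01 ext]]] := port_extension a.
  (* The label [c1 - c0] marks the only core edge at [a] colored [c1]; the transposition moves this
     label to [b]. It fixes 0 because [c0 != c1]. *)
  apply: (ext e (tperm (lift ord0 b) (c1 - c0)%R)); first exact: perm_inj.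
    by rewrite tpermD // subr_eq0 eq_sym.
  move=> b' _; have [->|b'b _] := eqVneq b' b; first by rewrite del_self.
  apply: contraNneq b'b => E; apply/eqP/(@lift_inj _ ord0).
  apply: (@perm_inj _ (tperm (lift ord0 b) (c1 - c0)%R)).
  by apply: (@addrI _ c0); rewrite E tpermL [RHS]addrC subrK.
have port_endE (x : old) (a : port) : val x == val a -> inl x = Old (port_end a).
  by move=> xa; congr inl; apply: val_inj; apply/eqP.
case: u w uw De => [x|[a|b]] [y|[a'|b']] //=.
- move=> xy De; have [e0 De0] := adj_edge xy.
  have /edge_colorableP[c [c_sym c_prop]] := del_col e0.
  have del0 (p q : G) : @adj (delete_edge e0) p q = adj p q && ([set p; q] != [set val x; val y]).
    by rewrite -De0.
  have del0v (a : port) : adj v (val a) && ([set v; val a] != [set val x; val y]).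
    rewrite (valP a) eq_set2 ![v == _]eq_sym.
    by rewrite (negPf (valP x)) (negPf (valP y)).
  have del0_old (p q : old) : del_adj e (Old p) (Old q) ->
      adj (val p) (val q) && ([set val p; val q] != [set val x; val y]).
    case/andP=> /= pq e_pq; rewrite pq; apply: contra e_pq.
    by rewrite De !eq_set2.
  (* The deleted edge avoids [v], so the colors at [v] are pairwise distinct and serve as both inner
     and outer colors. *)
  apply: (@extend_coloringP e c (fun a => c v (val a)) (fun a => c v (val a)) id) => //.
  + move=> p q r /del0_old pq /del0_old pr E; apply: val_inj.
    by apply: c_prop E; rewrite del0.
  + move=> a q _ /del0_old aq; rewrite (c_sym v); apply: contraNneq (old_neq q) => E.
    apply/eqP; apply: c_prop E; first by rewrite del0.
    by rewrite del0 adj_sym setUC.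
  + by move=> a a' E; apply: val_inj; apply: c_prop E; rewrite del0.
  by move=> a b _ _; rewrite -[X in _ != X]addr0 (inj_eq (@addrI _ _)) eq_sym neq_lift.
- by move=> /port_endE->; apply: case_port.
- by move=> /port_endE->; rewrite setUC; apply: case_port.
- by move=> _; apply: case_core.
by move=> _; rewrite setUC; apply: case_core.
Qed.

End Criticality.

(** * Connectedness and maximum degree of the extension *)

Lemma meredith_connected : connected_graph G -> connected_graph meredith.
Proof.
move=> conn; have /card_gt0P[port0 _] : 0 < #|{: port}| by rewrite card_port.
suff to_core (u : meredith) : connect (@adj meredith) (Core ord0) u.
  move=> u w; apply: connect_trans (to_core w).
  by rewrite (sym_connect_sym (@adj_sym meredith)).
have to_port (a : port) : connect (@adj meredith) (Core ord0) (Port a) by apply: connect1.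
have to_core b : connect (@adj meredith) (Core ord0) (Core b).
  by apply: connect_trans (to_port port0) _; apply: connect1.
(* Walks are transferred with [v] sent to a core; an edge at [v] becomes a walk of length two
   through a port. *)
pose f (x : G) : meredith := if insub x is Some x' then Old x' else Core ord0.
have fv : f v = Core ord0 by rewrite /f insubF ?eqxx.
have f_old (x : old) : f (val x) = Old x by rewrite /f valK.
have f_port x : adj v x -> connect (@adj meredith) (f v) (f x).
  move=> vx; pose a : port := exist (fun x => adj v x) x vx.
  have -> : f x = Old (port_end a) by rewrite -f_old.
  by rewrite fv; apply: connect_trans (to_port a) (connect1 _); rewrite /= eqxx.
have f_connect x y : connect (@adj G) x y -> connect (@adj meredith) (f x) (f y).
  case/connectP=> p; elim: p x => [|z p IHp] x /= => [_ ->|/andP[xz zp] Ey]; first exact: connect0.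
  apply: connect_trans (IHp _ zp Ey).
  have [xv|xv] := eqVneq x v; first by rewrite xv in xz *; apply: f_port.
  have [zv|zv] := eqVneq z v.
    by rewrite zv (sym_connect_sym (@adj_sym meredith)); apply: f_port; rewrite adj_sym -zv.
  by apply: connect1; rewrite /f !insubT.
case: u => [x|[a|b]]; [|exact: to_port|exact: to_core].
by rewrite -fv -[inl x]f_old; apply: f_connect; apply: conn.
Qed.

Lemma core_degree (b : 'I_k.+1) : #|[set w : meredith | @adj meredith (Core b) w]| = k.+2.
Proof.
have -> : [set w : meredith | @adj meredith (Core b) w] = [set Port a | a in [set: port]].
  apply/setP=> -[x|[a|b']]; rewrite inE /=; last 2 first.
  - by rewrite imset_f ?inE.
  - by symmetry; apply/imsetP=> -[].
  by symmetry; apply/imsetP=> -[].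
by rewrite card_imset ?cardsT ?card_port // => a a' [].
Qed.

Lemma meredith_max_degree : max_degree G = k.+2 -> max_degree meredith = k.+2.
Proof.
move=> max_deg; apply/eqP; rewrite eqn_leq; apply/andP; split; last first.
  by rewrite -(core_degree ord0); apply: leq_bigmax.
apply/bigmax_leqP=> -[x|[a|b]] _; last by rewrite core_degree.
  rewrite -max_deg; apply: leq_trans (leq_bigmax (val x)).
  (* An old vertex has at most one port as neighbor, which stands for [v]. *)
  apply: (@card_le_inj_in _ _ (fun w : meredith => if w is inl y then val y else v)).
    move=> [y|[a|b]] [z|[a'|b']]; rewrite !inE //=.
    - by move=> _ _ /val_inj->.
    - by move=> _ _ /eqP; rewrite (negPf (old_neq y)).
    - by move=> _ _ /esym/eqP; rewrite (negPf (old_neq z)).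
    by move=> /eqP xa /eqP xa' _; congr (inr (inl _)); apply: val_inj; apply: etrans (esym xa) xa'.
  move=> [y|[a|b]]; rewrite !inE //= => /eqP->.
  by rewrite adj_sym (valP a).
rewrite -[X in _ <= X](card_ord k.+2) -cardsT.
(* A port sees k+1 cores and one old vertex; the latter is sent to [ord0], which [lift ord0]
   avoids. *)
apply: (@card_le_inj_in _ _ (fun w : meredith =>
          if w is inr (inr b) then lift ord0 b else ord0)) => [|w]; last by rewrite inE.
move=> [y|[a'|b']] [z|[a''|b'']]; rewrite !inE //=.
- by move=> /eqP ya /eqP za _; congr inl; apply: val_inj; apply: etrans ya (esym za).
by move=> _ _ /lift_inj->.
Qed.

Lemma meredith_critical : k_critical k.+2 G -> k_critical k.+2 meredith.
Proof.
case/k_criticalP=> conn max_deg uncol del_col; apply/k_criticalP; split.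
- exact: meredith_connected.
- exact: meredith_max_degree.
- exact: meredith_uncolorable.
exact: meredith_delete.
Qed.

(** * Order and independence number of the extension *)

Lemma card_meredith : #|meredith| = (#|G| + k.+1.*2)%N.
Proof.
have -> : #|meredith| = #|{: old + (port + 'I_k.+1)}| by [].
rewrite !card_sum card_port card_ord card_sig.
have := cardC1 v; have : 0 < #|G| by apply/card_gt0P; exists v.
rewrite -addnn; case: #|G| => // n _ /= ->.
by rewrite !(addSn, addnS).
Qed.

Lemma card_meredith_set (S : {set meredith}) :
  #|S| = (#|[set x | Old x \in S]| + (#|[set a | Port a \in S]| + #|[set b | Core b \in S]|))%N.
Proof. by rewrite -!sum1dep_card -sum1_card big_sumType big_sumType. Qed.

Lemma card_old_set (S : {set G}) : #|[set x : old | val x \in S]| = #|S :\ v|.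
Proof.
rewrite -(card_imset _ val_inj); apply: eq_card => y; rewrite !inE.
apply/imsetP/andP=> [[x] + ->|[yv yS]]; first by rewrite inE => ->; rewrite old_neq.
by exists (exist (fun x => x != v) y yv); rewrite ?inE.
Qed.

Lemma meredith_independence_number :
  independence_number meredith = (independence_number G + k.+1)%N.
Proof.
apply/eqP; rewrite eqn_leq; apply/andP; split.
  have [S indS ->] := max_independent meredith.
  rewrite card_meredith_set.
  set O := [set x | Old x \in S]; set P := [set a | Port a \in S]; set C := [set b | Core b \in S].
  pose S0 := [set val x | x in O].
  have cardS0 : #|S0| = #|O| by rewrite card_imset //; apply: val_inj.
  have indS0 : independent S0.
    apply/independentP=> _ _ /imsetP[x xO ->] /imsetP[y yO ->].
    by move: xO yO; rewrite !inE; apply: (independentP _ indS).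
  have vS0 : v \notin S0.
    by apply/imsetP=> -[x _ xv]; have := old_neq x; rewrite -xv eqxx.
  have PC (a : port) b : a \in P -> b \in C -> False.
    by rewrite !inE => aS bS; have := independentP _ indS _ _ aS bS.
  have leC : #|C| <= k.+1 by rewrite -[X in _ <= X]card_ord max_card.
  (* If all k+2 ports are in [S], then no neighbor of [v] is in [S0], and [v] joins [S0] in exchange
     for one port. Otherwise ports and cores, which exclude each other, contribute at most k+1. *)
  have [PT|/eqP PT] := eqVneq P setT.
    have -> : #|C| = 0.
      apply/eqP; rewrite cards_eq0; apply/set0Pn=> -[b bC].
      have /card_gt0P[a _] : 0 < #|{: port}| by rewrite card_port.
      by apply: (PC a b) => //; rewrite PT inE.
    rewrite PT cardsT card_port addn0 -cardS0 addnS -addSn leq_add2r.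
    have -> : #|S0|.+1 = #|v |: S0| by rewrite cardsU1 vS0.
    apply: leq_independence_number; apply/independentP=> x y.
    have v_free z : z \in S0 -> ~~ adj v z.
      case/imsetP=> w; rewrite inE => wS ->; apply/negP=> vw.
      pose a : port := exist (fun x => adj v x) (val w) vw.
      have aS : a \in P by rewrite PT inE.
      rewrite inE in aS; have := independentP _ indS _ _ wS aS.
      by rewrite /= eqxx.
    case/setU1P=> [->|xS] /setU1P[->|yS]; rewrite ?adj_irrefl //.
    - exact: v_free.
    - by rewrite adj_sym; apply: v_free.
    exact: (independentP _ indS0).
  apply: leq_add; first by rewrite -cardS0; apply: leq_independence_number.
  have [->|/set0Pn[a aP]] := eqVneq P set0; first by rewrite cards0.
  have -> : #|C| = 0.
    by apply/eqP; rewrite cards_eq0; apply/set0Pn=> -[b /(PC a b aP)].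
  by rewrite addn0 -ltnS -card_port -cardsT proper_card // properT; apply/eqP.
have [S indS ->] := max_independent G.
(* All ports replace [v] if it lies in [S], for a net gain of k+1; otherwise all k+1 cores are
   added. *)
pose S' := [set u : meredith | match u with
  | inl x => val x \in S | inr (inl _) => v \in S | inr (inr _) => v \notin S end].
have indS' : independent S'.
  apply/independentP=> -[x|[a|b]] [y|[a'|b']]; rewrite !inE //=.
  - exact: (independentP _ indS).
  - move=> xS vS; apply/negP=> /eqP xa; have := independentP _ indS _ _ vS xS.
    by rewrite xa (valP a').
  - move=> vS yS; apply/negP=> /eqP ya; have := independentP _ indS _ _ vS yS.
    by rewrite ya (valP a).
  - by move=> ->.
  by move=> /negPf->.
apply: leq_trans (leq_independence_number indS').
rewrite card_meredith_set.
have -> : [set x | Old x \in S'] = [set x : old | val x \in S] by apply/setP=> x; rewrite !inE.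
have -> : [set a | Port a \in S'] = [set a : port | v \in S] by apply/setP=> x; rewrite !inE.
have -> : [set b | Core b \in S'] = [set b : 'I_k.+1 | v \notin S] by apply/setP=> x; rewrite !inE.
rewrite card_old_set (cardsD1 v S); case: (v \in S) => /=.
  have -> : [set _ : port | true] = setT by apply/setP=> x; rewrite !inE.
  by rewrite cardsT card_port addnA add1n addSnnS leq_addr.
have -> : [set _ : 'I_k.+1 | true] = setT by apply/setP=> x; rewrite !inE.
by rewrite cardsT card_ord add0n leq_add2l leq_addl.
Qed.

End MeredithExtension.

(** * Iterating the extension *)

Lemma k_critical_extension (k : nat) (G : sgraph) : k_critical k.+2 G ->
  exists G' : sgraph, [/\ k_critical k.+2 G', #|G'| = (#|G| + k.+1.*2)%N &
    independence_number G' = (independence_number G + k.+1)%N].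
Proof.
move=> critG; have [_ max_deg _ _] := critG.
have G_gt0 : 0 < #|G|.
  rewrite lt0n; apply: contraPneq max_deg => G0; rewrite /max_degree big1 // => x.
  by have := max_card (pred1 x); rewrite card1 G0.
have [v deg_v] := bigop.eq_bigmax (fun x : G => #|[set y | adj x y]|) G_gt0.
have {}deg_v : #|[set y | adj v y]| = k.+2 by rewrite -deg_v.
exists (meredith k v); split; first exact: meredith_critical.
  exact: card_meredith.
exact: meredith_independence_number.
Qed.

Lemma k_critical_iter_extension (k t : nat) (G : sgraph) : k_critical k.+2 G ->
  exists G' : sgraph, [/\ k_critical k.+2 G', #|G'| = (#|G| + t * k.+1.*2)%N &
    independence_number G' = (independence_number G + t * k.+1)%N].
Proof.
elim: t => [|t IHt] critG; first by exists G; rewrite !mul0n !addn0.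
have [G' [critG' card_G' alpha_G']] := IHt critG.
have [H [critH card_H alpha_H]] := k_critical_extension critG'.
exists H; split=> //; first by rewrite card_H card_G' mulSn addnAC addnA.
by rewrite alpha_H alpha_G' mulSn addnAC addnA.
Qed.

(** * Independence ratios close to one half *)

Local Open Scope ring_scope.

Lemma ratio_le_half (R : realType) (G : sgraph) : (0 < #|G|)%N ->
  (independence_ratio R G <= 1 / 2) = ((independence_number G).*2 <= #|G|)%N.
Proof.
move=> G_gt0; rewrite /independence_ratio ler_pdivrMr ?ltr0n // mulrAC mul1r.
by rewrite ler_pdivlMr ?ltr0n // mulr_natr -mulrnA muln2 ler_nat.
Qed.

Lemma near_half_counterexample (R : realType) (eps : R) (k : nat) (G : sgraph) :
  0 < eps -> k_critical k.+2 G -> ~~ (independence_ratio R G <= 1 / 2) ->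
  exists G' : sgraph, [/\ k_critical k.+2 G', ~~ (independence_ratio R G' <= 1 / 2) &
    independence_ratio R G' < 1 / 2 + eps].
Proof.
move=> eps_gt0 critG.
have [G0|G_gt0] := posnP #|G|.
  (* Division by zero gives 0, so the empty graph is no counterexample. *)
  by rewrite /independence_ratio G0 invr0 mulr0 divr_ge0.
rewrite ratio_le_half // -ltnNge => counter.
set a := independence_number G in counter *.
(* With n the order of [G], the final ratio is (a + t(k+1)) / (n + 2t(k+1)); it is below 1/2 + eps
   once a < n/2 + eps n + 2 eps t(k+1), for which eps t > a suffices. *)
pose t := Num.bound (a%:R / eps).
have t_large : a%:R < eps * t%:R.
  rewrite mulrC -ltr_pdivrMr //; apply: archi_boundP.
  by rewrite divr_ge0 ?ler0n // ltW.
have [G' [critG' cardG' alphaG']] := k_critical_iter_extension t critG.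
have G'_gt0 : (0 < #|G'|)%N by rewrite cardG' addn_gt0 G_gt0.
exists G'; split=> //.
  (* Twice the independence number and the order grow equally, so the strict inequality persists. *)
  by rewrite ratio_le_half // -ltnNge alphaG' cardG' doubleD doubleMr ltn_add2r.
rewrite /independence_ratio ltr_pdivrMr ?ltr0n // alphaG' cardG' -/a.
rewrite -muln2 !natrD !natrM.
have t_le : eps * t%:R <= eps * (t%:R * k.+1%:R).
  by rewrite ler_pM2l // ler_peMr ?ler0n // ler1n.
have n_ge0 : 0 <= eps * #|G|%:R by rewrite mulr_ge0 ?ler0n // ltW.
have : 0 <= (#|G|%:R : R) by [].
have : 0 <= (a%:R : R) by [].
by lra.
Qed.

Theorem theorem2p12 (R : realType) (eps : R) (eps_gt0 : 0 < eps) :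
  exists Ceps : sgraph -> Prop,
    [/\ forall G : sgraph, Ceps G -> critical G,
        (forall G : sgraph, critical G -> independence_ratio R G <= 1 / 2) <->
        (forall G : sgraph, Ceps G -> independence_ratio R G <= 1 / 2) &
        forall G : sgraph, Ceps G -> independence_ratio R G < 1 / 2 + eps].
Proof.
exists (fun G => critical G /\ independence_ratio R G < 1 / 2 + eps).
split=> [G []//||G []//]; split=> [half G [critG _]|half G [k [k_ge2 critG]]].
  exact: half.
case: k k_ge2 critG => [|[|k]] // _ critG; apply: contraT => counter.
have [G' [critG' counter' small]] := near_half_counterexample eps_gt0 critG counter.
by case/negP: counter'; apply: half; split=> //; exists k.+2.
Qed.
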